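(* For all integers $c,d$ with $3\leq c\leq d$ there is no integer $k\geq 2$ such that the $k$-th level of the affine integer programming ($\mathrm{AIP}$) hierarchy solves $\mathrm{PCSP}(\mathbf{K}_c,\mathbf{K}_d)$. That is, for every $k\ge 2$ there exists a finite digraph $\mathbf{G}$ with $\mathrm{AIP}^k(\mathbf{G},\mathbf{K}_c)=\textsc{Yes}$ but $\mathbf{G}\not\to\mathbf{K}_d$.
   Context: A digraph $\mathbf{H}$ consists of a finite vertex set $\mathcal{V}(\mathbf{H})$ and an edge set $\mathcal{E}(\mathbf{H})\subseteq\mathcal{V}(\mathbf{H})^2$. A homomorphism $\mathbf{G}\to\mathbf{H}$ is a map $f:\mathcal{V}(\mathbf{G})\to\mathcal{V}(\mathbf{H})$ with $(f(g_1),f(g_2))\in\mathcal{E}(\mathbf{H})$ whenever $(g_1,g_2)\in\mathcal{E}(\mathbf{G})$; $\mathbf{G}\to\mathbf{H}$ denotes existence of one. $\mathbf{K}_p$ is the digraph on $\{1,\dots,p\}$ whose edges are all pairs of distinct vertices. For digraphs $\mathbf{H}\to\tilde{\mathbf{H}}$, $\mathrm{PCSP}(\mathbf{H},\tilde{\mathbf{H}})$ is the promise problem: given $\mathbf{G}$, answer Yes if $\mathbf{G}\to\mathbf{H}$ and No if $\mathbf{G}\not\to\tilde{\mathbf{H}}$. For a set $V$ let $\binom{V}{\le k}=\{S\subseteq V:1\le|S|\le k\}$. For digraphs $\mathbf{G},\mathbf{H}$ and $k\ge 2$, introduce a variable $\lambda_S(f)$ for each $S\in\binom{\mathcal{V}(\mathbf{G})}{\le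 k}$ and each $f:S\to\mathcal{V}(\mathbf{H})$, and a variable $\lambda_{\mathbf{g}}(f)$ for each $\mathbf{g}=(g_1,g_2)\in\mathcal{E}(\mathbf{G})$ and each $f:\{g_1,g_2\}\to\mathcal{V}(\mathbf{H})$. The constraints are: (1) $\sum_{f:S\to\mathcal{V}(\mathbf{H})}\lambda_S(f)=1$ for every $S\in\binom{\mathcal{V}(\mathbf{G})}{\le k}$; (2) $\lambda_R(f)=\sum_{\tilde f:S\to\mathcal{V}(\mathbf{H}),\ \tilde f|_R=f}\lambda_S(\tilde f)$ for all $\emptyset\ne R\subseteq S\in\binom{\mathcal{V}(\mathbf{G})}{\le k}$ and $f:R\to\mathcal{V}(\mathbf{H})$; (3) $\lambda_R(f)=\sum_{\tilde f:\{g_1,g_2\}\to\mathcal{V}(\mathbf{H}),\ \tilde f|_R=f}\lambda_{\mathbf{g}}(\tilde f)$ for all $\mathbf{g}\in\mathcal{E}(\mathbf{G})$, $\emptyset\ne R\subseteq\{g_1,g_2\}$, $f:R\to\mathcal{V}(\mathbf{H})$; (4) $\lambda_{\mathbf{g}}(f)=0$ for all $\mathbf{g}\in\mathcal{E}(\mathbf{G})$ and $f:\{g_1,g_2\}\to\mathcal{V}(\mathbf{H})$ with $(f(g_1),f(g_2))\notin\mathcal{E}(\mathbf{H})$. $\mathrm{AIP}^k(\mathbf{G},\mathbf{H})=\textsc{Yes}$ iff this system has a solution with all variables integers. The $k$-th level of AIP solves $\mathrm{PCSP}(\mathbf{H},\tilde{\mathbf{H}})$ if $\mathbf{G}\to\tilde{\mathbf{H}}$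 for every digraph $\mathbf{G}$ with $\mathrm{AIP}^k(\mathbf{G},\mathbf{H})=\textsc{Yes}$. *)

(* Defs.v *)
From HB Require Import structures.
From mathcomp Require Import all_boot all_order all_algebra.

Set Implicit Arguments.
Unset Strict Implicit.
Unset Printing Implicit Defensive.

Import GRing.Theory.
Local Open Scope ring_scope.

Record digraph := Digraph { vertex : finType; edge : rel vertex }.

Definition is_hom (G H : digraph) (f : vertex G -> vertex H) : Prop :=
  forall x y, edge x y -> edge (f x) (f y).

Definition homs (G H : digraph) : Prop :=
  exists f : vertex G -> vertex H, is_hom f.

(* The vertices of K_p are numbered 0, ..., p-1. *)
Definition complete_digraph (p : nat) : digraph :=
  @Digraph 'I_p (fun x y => x != y).

Section LocalMaps.
Variables V W : finType.

Definition local_map (S : {set V}) : finType := {ffun {x : V | x \in S} -> W}.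

Definition incl (R S : {set V}) (sRS : R \subset S) (x : {x : V | x \in R}) :
    {x : V | x \in S} :=
  exist _ (val x) (subsetP sRS (val x) (valP x)).

Definition restrict (R S : {set V}) (sRS : R \subset S) (f : local_map S) :
    local_map R :=
  [ffun x => f (incl sRS x)].

Definition fst_val (g1 g2 : V) (f : local_map [set g1; g2]) : W :=
  f (exist _ g1 (set21 g1 g2)).

Definition snd_val (g1 g2 : V) (f : local_map [set g1; g2]) : W :=
  f (exist _ g2 (set22 g1 g2)).

End LocalMaps.

(* The families lam and mu are total: lam S is a variable of the system only   *)
(* when 1 <= #|S| <= k, and mu g1 g2 only when (g1, g2) is an edge of G; all   *)
(* other values are unconstrained and irrelevant. A loop (g, g) of G has the   *)
(* one-element scope [set g; g].                                               *)
Definition AIP (k : nat) (G H : digraph) : Prop :=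
  exists (lam : forall S : {set vertex G}, local_map (vertex H) S -> int)
         (mu : forall g1 g2 : vertex G,
                 local_map (vertex H) [set g1; g2] -> int),
  [/\ (forall S : {set vertex G}, (1 <= #|S| <= k)%N ->
         \sum_(f : local_map (vertex H) S) lam S f = 1),
      (forall (R S : {set vertex G}) (sRS : R \subset S),
         R != set0 -> (1 <= #|S| <= k)%N ->
         forall f : local_map (vertex H) R,
         lam R f = \sum_(f' | restrict sRS f' == f) lam S f'),
      (forall g1 g2 : vertex G, edge g1 g2 ->
         forall (R : {set vertex G}) (sRg : R \subset [set g1; g2]),
         R != set0 ->
         forall f : local_map (vertex H) R,
         lam R f = \sum_(f' | restrict sRg f' == f) mu g1 g2 f')
    & (forall g1 g2 : vertex G, edge g1 g2 ->
         forall f : local_map (vertex H) [set g1; g2],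
         ~~ edge (fst_val f) (snd_val f) -> mu g1 g2 f = 0)].

(* The promise problem PCSP(H, H') presupposes homs H H'. *)
Definition AIP_solves_PCSP (k : nat) (H H' : digraph) : Prop :=
  forall G : digraph, AIP k G H -> homs G H'.

Lemma complete_digraph_homs (c d : nat) :
  (c <= d)%N -> homs (complete_digraph c) (complete_digraph d).
Proof.
by move=> le_cd; exists (widen_ord le_cd) => x y /=; apply: contra_neq => /(congr1 val) /= /val_inj.
Qed.

(* Main.v *)
Require Import Defs.
From mathcomp Require Import all_boot all_order all_algebra.

(** All levels of the hierarchy are fooled at once by the clique on d+1 vertices. It suffices
    to find an integer-valued function L on all maps h : V(K_n) -> V(K_c), of total mass 1, such
    that for all x != y and every colour a the maps with h x = h y = a have total mass 0; the
    variables of the system are then the marginals of L. Fix three distinct colours r, s, t and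
    let [i:u, j:v] be the map sending i to u, j to v and everything else to t. Then

      L = [constant r] - sum over i < j of ([i:r, j:r] - [i:r, j:s])

    works: the (i, j)-th difference has mass 0 and its only nonzero monochromatic pair marginal
    is the one at {i, j} in colour r, where it cancels the contribution of the constant map. *)

Set Implicit Arguments.
Unset Strict Implicit.
Unset Printing Implicit Defensive.

Import GRing.Theory.
Local Open Scope ring_scope.

Section Marginals.
Variables V W : finType.
Implicit Types (S R : {set V}) (L : {ffun V -> W} -> int).

Definition restr_to S (h : {ffun V -> W}) : local_map W S :=
  [ffun x => h (val x)].

Definition marginal L S (f : local_map W S) : int :=
  \sum_(h | restr_to S h == f) L h.

Lemma restrict_restr_to S R (sRS : R \subset S) h :
  restrict sRS (restr_to S h) = restr_to R h.
Proof. by apply/ffunP => x; rewrite !ffunE. Qed.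

Lemma sum_marginal L S : \sum_(f : local_map W S) marginal L f = \sum_h L h :> int.
Proof. by rewrite (partition_big (restr_to S) predT). Qed.

(** Group the maps [h] that extend [f] by their restriction to [S]. *)
Lemma marginal_restrict L S R (sRS : R \subset S) (f : local_map W R) :
  marginal L f = \sum_(f' | restrict sRS f' == f) marginal L f'.
Proof.
rewrite /marginal (partition_big (restr_to S) (fun f' => restrict sRS f' == f)).
  apply: eq_bigr => f' /eqP <-; apply: eq_bigl => h.
  by rewrite andb_idl // => /eqP <-; rewrite restrict_restr_to.
by move=> h; rewrite restrict_restr_to.
Qed.

Lemma restr_to_pair (g1 g2 : V) h (f : local_map W [set g1; g2]) :
  (restr_to [set g1; g2] h == f) = (h g1 == fst_val f) && (h g2 == snd_val f).
Proof.
apply/eqP/andP=> [<-|[/eqP h1 /eqP h2]]; first by rewrite /fst_val /snd_val !ffunE.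
apply/ffunP => -[x xg]; rewrite ffunE /=.
have [xg1|xg2] := set2P xg; subst x.
  by rewrite h1; congr (f _); apply: val_inj.
by rewrite h2; congr (f _); apply: val_inj.
Qed.

End Marginals.

Section HollowFunction.
Variables (n : nat) (W : finType) (r s t : W).
Hypotheses (rs : r != s) (rt : r != t) (st : s != t).
Implicit Types (i j x y : 'I_n) (h : {ffun 'I_n -> W}).

Definition paint i j (u v : W) : {ffun 'I_n -> W} :=
  [ffun z => if z == i then u else if z == j then v else t].

Definition hollow h : int :=
  (h == [ffun=> r])%:R -
  \sum_(p : 'I_n * 'I_n | (p.1 < p.2)%N)
     ((h == paint p.1 p.2 r r)%:R - (h == paint p.1 p.2 r s)%:R).

Lemma sum_indicator (P : pred {ffun 'I_n -> W}) h0 :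
  \sum_(h | P h) (h == h0)%:R = (P h0)%:R :> int.
Proof.
case Ph: (P h0); last first.
  by rewrite big1 // => h Qh; case: eqP => // e; rewrite e Ph in Qh.
rewrite (bigD1 h0) //= eqxx big1 ?addr0 // => h /andP[_ /negPf ->] //.
Qed.

Lemma sum_hollow_on (P : pred {ffun 'I_n -> W}) :
  \sum_(h | P h) hollow h =
  (P [ffun=> r])%:R -
  \sum_(p : 'I_n * 'I_n | (p.1 < p.2)%N)
     ((P (paint p.1 p.2 r r))%:R - (P (paint p.1 p.2 r s))%:R).
Proof.
rewrite sumrB sum_indicator exchange_big /=; congr (_ - _).
by apply: eq_bigr => p _; rewrite sumrB !sum_indicator.
Qed.

Lemma sum_hollow : \sum_h hollow h = 1.
Proof. by rewrite sum_hollow_on big1 ?subr0 // => p _; rewrite subrr. Qed.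

Lemma hollow_diag x y (a : W) : x != y ->
  \sum_(h : {ffun 'I_n -> W} | (h x == a) && (h y == a)) hollow h = 0.
Proof.
(* The claim is symmetric in [x] and [y], while [hollow] indexes its differences by increasing
   pairs. *)
wlog lt_xy : x y / (x < y)%N => [hw nxy|_].
  have /orP[lt|lt] : (x < y)%N || (y < x)%N by rewrite -neq_ltn.
    exact: hw.
  by under eq_bigl do rewrite andbC; apply: hw => //; rewrite eq_sym.
have not_both u v : u != v -> (u == a) && (v == a) = false.
  by move=> uv; apply/negP => /andP[/eqP ua /eqP va]; rewrite ua va eqxx in uv.
have [ts tr sr] : [/\ t != s, t != r & s != r] by split; rewrite eq_sym.
have yx : (y == x) = false by apply/eqP => e; rewrite e ltnn in lt_xy.
rewrite (sum_hollow_on [pred h : {ffun _} | (h x == a) && (h y == a)]).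
(* The pair [(x, y)] contributes the indicator of [r == a], cancelling the constant map. *)
rewrite (bigD1 (x, y)) //= !ffunE !eqxx yx andbb (not_both r s) // subr0.
(* The two maps of any other pair differ only at [j], so only [j = y] or [j = x] matters. The other
   point is then not [i] (for [j = x], because [y = i] would give [y < x]), so it has colour [t],
   while [j] has colour [r] or [s]: both indicators vanish. *)
rewrite big1 ?addr0 ?subrr // => -[i j] /= /andP[lt_ij neq].
rewrite !ffunE; move: neq; rewrite -pair_eqE /= [i == x]eq_sym [j == y]eq_sym.
case: (eqVneq x i) => xi; case: (eqVneq y j) => yj //= _;
  case: (eqVneq y i) => yi; case: (eqVneq x j) => xj;
  rewrite ?(not_both _ _ rs, not_both _ _ rt, not_both _ _ st);
  rewrite ?(not_both _ _ sr, not_both _ _ tr, not_both _ _ ts) ?subrr //;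
  subst; rewrite ?ltnn // in lt_xy lt_ij;
  by have := ltn_trans lt_xy lt_ij; rewrite ltnn.
Qed.

End HollowFunction.

Lemma AIP_complete (k n c : nat) : (3 <= c)%N ->
  AIP k (complete_digraph n) (complete_digraph c).
Proof.
case: c => [|[|[|c]]] // _.
pose r : 'I_c.+3 := inord 0; pose s : 'I_c.+3 := inord 1; pose t : 'I_c.+3 := inord 2.
have [rs rt st] : [/\ r != s, r != t & s != t].
  by rewrite -!val_eqE /= !inordK.
pose L := @hollow n 'I_c.+3 r s t.
(* Since [mu] is the same marginal on the edge's vertex set, (3) becomes an instance of
   marginalisation like (2). *)
exists (fun S => @marginal _ _ L S), (fun g1 g2 => @marginal _ _ L [set g1; g2]).
split=> [S _|R S sRS _ _ f|g1 g2 _ R sRg _ f|g1 g2 /= g12 f].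
- by rewrite sum_marginal sum_hollow.
- exact: marginal_restrict.
- exact: marginal_restrict.
(* A non-edge of the target is a pair of equal colours, and [g12] says that the two vertices are
   distinct. *)
- rewrite negbK => /eqP f12; rewrite /marginal.
  under eq_bigl do rewrite restr_to_pair -f12.
  exact: hollow_diag.
Qed.

(** Distinct vertices are adjacent and the target is loopless, so a homomorphism would be
    injective. *)
Lemma not_homs_complete (m d : nat) : (d < m)%N ->
  ~ homs (complete_digraph m) (complete_digraph d).
Proof.
move=> lt_dm [f f_hom].
have f_inj : injective f.
  by move=> x y fxy; apply/eqP; apply: contraTT isT => /f_hom /=; rewrite fxy eqxx.
by have := leq_card f f_inj; rewrite !card_ord leqNgt lt_dm.
Qed.

Local Close Scope ring_scope.

Theorem theorem2p1 (c d : nat) (hc : 3 <= c) (hcd : c <= d) :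
  (~ exists k : nat,
       2 <= k /\ AIP_solves_PCSP k (complete_digraph c) (complete_digraph d))
  /\ (forall k : nat, 2 <= k ->
       exists G : digraph,
         AIP k G (complete_digraph c) /\ ~ homs G (complete_digraph d)).
Proof.
split=> [[k [_ solves]]|k _].
  exact: (not_homs_complete (ltnSn d)) (solves _ (AIP_complete k d.+1 hc)).
exists (complete_digraph d.+1); split; first exact: AIP_complete.
exact: not_homs_complete.
Qed.
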